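(* Let $k\ge 2$, $m\ge 1$ be integers, and for $\theta>0$ let $\Gamma^{(1)},\dots,\Gamma^{(m)}$ be i.i.d. with distribution Gamma$(k,\theta)$. Let $\hat{\xi}=\dfrac{km-1}{\sum_{i=1}^m\Gamma^{(i)}}$. Let $\tilde{\xi}=\tilde{\xi}(\Gamma^{(1)},\dots,\Gamma^{(m)})$ be an unbiased estimator of $\theta$, i.e. $\mathbb{E}[\tilde{\xi}]=\theta$ for every $\theta>0$. Then $$\mathbb{E}[(\tilde{\xi}-\theta)^2]\ \geq\ \mathbb{E}[(\hat{\xi}-\theta)^2]\ =\ \frac{\theta^2}{km-2}.$$
   Context: Gamma$(k,\theta)$ denotes the law with density $\frac{t^{k-1}}{\Gamma(k)}\theta^k e^{-\theta t}\mathbf{1}_{t\ge 0}$. An estimator is a real-valued measurable function of the sample $(\Gamma^{(1)},\dots,\Gamma^{(m)})$, not depending on $\theta$; $k$ and $m$ are known and $\theta>0$ is the unknown parameter. *)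

(* Defs.v *)
From HB Require Import structures.
From mathcomp Require Import all_boot all_order all_algebra.
From mathcomp Require Import all_classical all_reals all_analysis.

Set Implicit Arguments.
Unset Strict Implicit.
Unset Printing Implicit Defensive.

Import Order.TTheory GRing.Theory Num.Theory.

Local Open Scope classical_set_scope.
Local Open Scope ring_scope.

Definition Gamma_fun (R : realType) (a : R) : R :=
  \int[lebesgue_measure]_(t in `]0, +oo[) (t `^ (a - 1) * expR (- t)).

(* The parameter theta is a rate, and the shape k is a positive integer. *)
Definition gamma_pdf (R : realType) (k : nat) (theta t : R) : R :=
  t ^+ k.-1 / Gamma_fun k%:R * theta ^+ k * expR (- theta * t)
    * \1_(`[0, +oo[%classic : set R) t.

Definition gamma_law (R : realType) (k : nat) (theta : R) (A : set R) : \bar R :=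
  \int[lebesgue_measure]_(t in A) (gamma_pdf k theta t)%:E.

Definition mutually_independent (d : measure_display) (T : measurableType d)
    (R : realType) (P : probability T R) (I : finType)
    (X : I -> {RV P >-> R}) : Prop :=
  forall (J : {set I}) (A : I -> set R), (forall i, measurable (A i)) ->
    P (\bigcap_(i in [set` J]) (X i @^-1` A i)) =
    (\prod_(i in J) P (X i @^-1` A i))%E.

Arguments mutually_independent {d T R} P {I} X.

Definition iid_gamma (d : measure_display) (T : measurableType d)
    (R : realType) (P : probability T R) (k m : nat) (theta : R)
    (X : 'I_m -> {RV P >-> R}) : Prop :=
  mutually_independent P X /\
  forall (i : 'I_m) (A : set R), measurable A ->
    distribution P (X i) A = gamma_law k theta A.

Arguments iid_gamma {d T R} P k {m} theta X.

Definition sample (T : Type) (R : realType) (m : nat)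
    (X : 'I_m -> T -> R) (w : T) : m.-tuple R :=
  [tuple X i w | i < m].

Definition xi_hat (R : realType) (k m : nat) (x : m.-tuple R) : R :=
  ((k * m)%:R - 1) / \sum_(i < m) tnth x i.

Definition mean_square_error (d : measure_display) (T : measurableType d)
    (R : realType) (P : probability T R) (m : nat)
    (X : 'I_m -> {RV P >-> R}) (xi : m.-tuple R -> R) (theta : R) : \bar R :=
  ('E_P[fun w => ((xi (sample X w) - theta) ^+ 2)%R])%E.

Arguments mean_square_error {d T R} P {m} X xi theta.

(* Main.v *)
Require Import Defs.
From HB Require Import structures.
From mathcomp Require Import all_boot all_order all_algebra.
From mathcomp Require Import all_classical all_reals all_analysis.
From mathcomp Require Import measurable_realfun ring lra.

(** Write [n = k m] and let [S] be the sum of the sample. The proof rests on a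
single property of gamma samples: damping the law of the sample by [e^(-uS)]
only changes the rate. For every nonnegative statistic [f] (lemma
[change_of_rate]),

  [E_theta (e^(-uS) f) = (theta / (theta + u))^n E_(theta+u) f].

Integrating this identity over [u] in a set [D] of nonnegative reals and
exchanging the integrals gives (lemma [integral_mixture])

  [E_theta (f * int_D e^(-uS) du)
     = int_D (theta / (theta + u))^n E_(theta+u) f du].

With [D] the half-line, the inner integral is [1/S], so [f = 1] and then
[f = 1/S] yield the first two inverse moments of [S]; hence
[xi_hat = (n-1)/S] is unbiased, with mean square error [theta^2 / (n-2)].

For the lower bound, let [xi] be unbiased. The right-hand side depends on [f]
only through its means under all the rates, and [xi] and [xi_hat] have the same
means; so they have the same correlation with every partial Laplace integral
[h_a = int_[0,a] e^(-uS) du]. Since [0 <= h_a <= 1/S], with [c = n - 1]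

  [c^2 E(h_a / S) = c E(xi_hat h_a) = c E(xi h_a)
     <= (E xi^2 + c^2 E h_a^2) / 2 <= (E xi^2 + c^2 E(h_a / S)) / 2],

that is, [c^2 E(h_a / S) <= E xi^2]. Here [h_a] is bounded by [a], so every
term but [E xi^2] is finite, and [a -> +oo] gives [E xi_hat^2 <= E xi^2]. The
truncation makes the argument uniform: it also covers [n = 2], where
[E xi_hat^2 = +oo] and the bound forces [E xi^2 = +oo]. As both estimators have
mean [theta], subtracting [theta^2] compares the mean square errors.

The value of [Gamma(k)] cancels throughout: the normalisation constant of the
density is the same at all rates, and that the densities have total mass one is
part of the assumption that the [X i] are distributed by the gamma laws. *)

Set Implicit Arguments.
Unset Strict Implicit.
Unset Printing Implicit Defensive.

Import Order.TTheory GRing.Theory Num.Theory.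

Local Open Scope classical_set_scope.
Local Open Scope ring_scope.

(** * Integrals of nonnegative real functions *)

Section integral_ge0_real.
Local Open Scope ereal_scope.
Context d (T : measurableType d) (R : realType).
Variable mu : {measure set T -> \bar R}.
Implicit Types f g : T -> R.

Lemma integralD_ge0_real f g :
  measurable_fun setT f -> measurable_fun setT g ->
  (forall x, 0 <= f x)%R -> (forall x, 0 <= g x)%R ->
  \int[mu]_x (f x + g x)%:E = \int[mu]_x (f x)%:E + \int[mu]_x (g x)%:E.
Proof.
move=> mf mg f0 g0; under eq_integral do rewrite EFinD.
rewrite ge0_integralD//; [|exact/measurable_EFinP|..|exact/measurable_EFinP].
- by move=> x _; rewrite lee_fin.
- by move=> x _; rewrite lee_fin.
Qed.

Lemma integralZl_ge0_real (r : R) f : (0 <= r)%R ->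
  measurable_fun setT f -> (forall x, 0 <= f x)%R ->
  \int[mu]_x (r * f x)%:E = r%:E * \int[mu]_x (f x)%:E.
Proof.
move=> r0 mf f0; under eq_integral do rewrite EFinM.
rewrite ge0_integralZl//; first exact/measurable_EFinP.
by move=> x _; rewrite lee_fin.
Qed.

Lemma integral_ge0_real f : (forall x, 0 <= f x)%R -> 0 <= \int[mu]_x (f x)%:E.
Proof. by move=> f0; apply: integral_ge0 => x _; rewrite lee_fin. Qed.

Lemma le_integral_ge0_real f g :
  measurable_fun setT f -> measurable_fun setT g ->
  (forall x, 0 <= f x)%R -> (forall x, f x <= g x)%R ->
  \int[mu]_x (f x)%:E <= \int[mu]_x (g x)%:E.
Proof.
move=> mf mg f0 fg; apply: ge0_le_integral => //.
- by move=> x _; rewrite lee_fin.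
- exact/measurable_EFinP.
- exact/measurable_EFinP.
- by move=> x _; rewrite lee_fin.
Qed.

End integral_ge0_real.

(** * Measures with a density *)

Section tilted.
Local Open Scope ereal_scope.
Context d (T : measurableType d) (R : realType).
Variables (mu : {measure set T -> \bar R}) (W : T -> R).
Hypotheses (mW : measurable_fun setT W) (W0 : forall x, (0 <= W x)%R).

(** The two proofs are arguments so that the measure structure declared below is
found from the term alone. *)
Definition tilted of measurable_fun setT W & (forall x, (0 <= W x)%R) :=
  fun A : set T => \int[mu]_(x in A) (W x)%:E.

Local Notation M := (tilted mW W0).

Let M0 : M set0 = 0. Proof. exact: integral_set0. Qed.

Let M_ge0 A : 0 <= M A.
Proof. by apply: integral_ge0 => x _; rewrite lee_fin. Qed.

Let M_sigma_additive : semi_sigma_additive M.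
Proof.
move=> F mF tF mUF; rewrite /tilted; apply: cvg_toP.
  apply: ereal_nondecreasing_is_cvgn => m n mn.
  by apply: lee_sum_nneg_natr => // k _ _; exact: M_ge0.
rewrite ge0_integral_bigcup//; first exact/measurable_funTS/measurable_EFinP.
by move=> x _; rewrite lee_fin.
Qed.

HB.instance Definition _ := isMeasure.Build _ _ _ M M0 M_ge0 M_sigma_additive.

Import HBNNSimple.

Let ge0_integral_tilted_nnsfun (h : {nnsfun T >-> R}) :
  \int[M]_x (h x)%:E = \int[mu]_x ((W x)%:E * (h x)%:E).
Proof.
rewrite integralT_nnsfun sintegralE.
transitivity (\int[mu]_x
    \sum_(r \in range h) r%:E * ((W x)%:E * (\1_(h @^-1` [set r]) x)%:E)).
  rewrite ge0_integral_fsum//; last 2 first.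
  - move=> r; apply/measurable_EFinP; apply: measurable_funM => //.
    exact: measurable_funM.
  - move=> r x _; rewrite muleCA mule_ge0 ?lee_fin//.
    exact: nnfun_muleindic_ge0.
  apply: eq_fsbigr => r; rewrite inE => -[y _ hy].
  have r0 : (0 <= r)%R by rewrite -hy.
  rewrite ge0_integralZl//; last 2 first.
  - by apply/measurable_EFinP; exact: measurable_funM.
  - by move=> x _; rewrite mule_ge0// lee_fin.
  congr (_ * _); rewrite /= /tilted integral_mkcond epatch_indic.
  exact: eq_integral.
apply: eq_integral => x _; rewrite fimfunE -fsumEFin// ge0_mule_fsumr.
  by apply: eq_fsbigr => r _; rewrite EFinM muleCA.
by move=> r; exact: nnfun_muleindic_ge0.
Qed.

Lemma ge0_integral_tilted (f : T -> \bar R) :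
  measurable_fun setT f -> (forall x, 0 <= f x) ->
  \int[M]_x f x = \int[mu]_x ((W x)%:E * f x).
Proof.
move=> mf f0.
pose g := nnsfun_approx measurableT mf.
have cvg_g x : (g n x)%:E @[n --> \oo] --> f x by exact: cvg_nnsfun_approx.
have nd_g x : nondecreasing_seq (fun n => (g n x)%:E).
  by move=> m n mn; rewrite lee_fin; exact/lefP/nd_nnsfun_approx.
have mg n : measurable_fun setT (fun x => (g n x)%:E).
  exact/measurable_EFinP.
transitivity (limn (fun n => \int[M]_x (g n x)%:E)).
  rewrite -monotone_convergence//.
  - by apply: eq_integral => x _; apply/esym/cvg_lim.
  - by move=> n x _; rewrite lee_fin.
transitivity (limn (fun n => \int[mu]_x ((W x)%:E * (g n x)%:E))).
  by apply/congr_lim/funext => n; exact: ge0_integral_tilted_nnsfun.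
rewrite -monotone_convergence//.
- by apply: eq_integral => x _; apply/cvg_lim => //; exact: cvgeZl.
- by move=> n; apply: emeasurable_funM => //; exact/measurable_EFinP.
- by move=> n x _; rewrite mule_ge0// lee_fin.
- by move=> x _ m n mn; apply: lee_wpmul2l; rewrite ?lee_fin//; exact: nd_g.
Qed.

End tilted.

(** Knowing the weighted image measure on sets is enough to integrate against it.
This serves both when [X] is the identity and [W] a probability density, and
when [X] is one coordinate of a sample and [W] a function of the others. *)
Lemma tilted_transfer d1 d2 (T1 : measurableType d1) (T2 : measurableType d2)
    (R : realType) (mu : {measure set T1 -> \bar R}) (W : T1 -> R)
    (X : T1 -> T2) (rho : {measure set T2 -> \bar R}) :
  measurable_fun setT W -> (forall x, 0 <= W x) -> measurable_fun setT X ->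
  (forall A, measurable A ->
    \int[mu]_(x in X @^-1` A) (W x)%:E = rho A)%E ->
  forall f : T2 -> \bar R, measurable_fun setT f -> (forall y, 0 <= f y)%E ->
  (\int[mu]_x ((W x)%:E * f (X x)) = \int[rho]_y f y)%E.
Proof.
move=> mW W0 mX muW f mf f0.
rewrite -(ge0_integral_tilted mu mW W0 (measurableT_comp mf mX))//; last first.
  by move=> x; exact: f0.
rewrite -(preimage_setT X) -(ge0_integral_pushforward mX)//.
  by apply: eq_measure_integral => A mA _; exact: muW.
Qed.

(** * Independence *)

(** Independence is the case of indicator functions. One coordinate at a time, the
indicator is replaced by an arbitrary function: with all the other factors
fixed, both sides are measures of the set whose indicator is taken, and they
agree on all sets. *)
Lemma integral_prod_independent d (T : measurableType d) (R : realType)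
    (P : probability T R) (I : finType) (X : I -> {RV P >-> R})
    (f : I -> R -> R) :
  mutually_independent P X ->
  (forall i, measurable_fun setT (f i)) -> (forall i x, 0 <= f i x) ->
  (forall i, \int[P]_w (f i (X i w))%:E < +oo)%E ->
  (\int[P]_w (\prod_i f i (X i w))%:E = \prod_i \int[P]_w (f i (X i w))%:E)%E.
Proof.
move=> indX.
(* [s] lists the coordinates whose factor may differ from an indicator *)
suff swap (s : seq I) : forall f : I -> R -> R,
    (forall i, measurable_fun setT (f i)) -> (forall i x, 0 <= f i x) ->
    (forall i, \int[P]_w (f i (X i w))%:E < +oo)%E ->
    (forall i, i \notin s -> exists2 A, measurable A & f i = \1_A) ->
    (\int[P]_w (\prod_i f i (X i w))%:E =
     \prod_i \int[P]_w (f i (X i w))%:E)%E.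
  by move=> mf f0 foo; apply: (swap (enum I)) => // i; rewrite mem_enum.
elim: s => [|j s IHs] {}f mf f0 foo find.
  have {find} /choice[A /all_and2[mA fA]] : forall i,
    exists A : set R, measurable A /\ f i = \1_A.
    by move=> i; have [//|A mA fA] := find i; exists A.
  have mXA i : measurable (X i @^-1` A i) by exact: measurable_funPTI.
  have mE : measurable (\bigcap_(i in [set` [set: I]%SET]) (X i @^-1` A i)).
    exact: fin_bigcap_measurable.
  transitivity (P (\bigcap_(i in [set` [set: I]%SET]) (X i @^-1` A i))).
    rewrite -[X in _ = P X]setIT -(integral_indic P measurableT mE).
    apply: eq_integral => w _; congr (_%:E).
    under eq_bigr do rewrite fA indicE.
    have [XA|/existsNP[i]] := pselect (forall i, A i (X i w)).
      rewrite big1; first by rewrite indicE mem_set// => i _; exact: XA.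
      by move=> i _; rewrite mem_set.
    move=> XA; rewrite (bigD1 i)//= memNset// mul0r.
    rewrite indicE memNset// => /(_ i); apply: contra_not XA; apply.
    by rewrite /= inE.
  rewrite indX//; apply: eq_big => [i|i _]; first by rewrite inE.
  rewrite -[X in P X]setIT -(integral_indic P measurableT (mXA i)).
  by apply: eq_integral => w _; rewrite fA.
have fin_int i : (\int[P]_w (f i (X i w))%:E)%E =
    (fine (\int[P]_w (f i (X i w))%:E)%E)%:E.
  rewrite fineK// ge0_fin_numE ?foo//; apply: integral_ge0 => w _.
  by rewrite lee_fin.
set F := fun i => fine (\int[P]_w (f i (X i w))%:E)%E in fin_int.
have F0 i : 0 <= F i.
  by apply/fine_ge0/integral_ge0 => w _; rewrite lee_fin.
have c0 : 0 <= \prod_(i | i != j) F i by exact: prodr_ge0.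
pose W w := \prod_(i | i != j) f i (X i w).
have mW : measurable_fun setT W.
  rewrite /W; under eq_fun do rewrite -big_filter.
  by apply: measurable_prod => i _; exact: measurableT_comp.
have W0 w : 0 <= W w by apply: prodr_ge0.
rewrite [RHS](bigD1 j)//= muleC.
under eq_integral => w _ do rewrite (bigD1 j)//= mulrC EFinM.
rewrite (@tilted_transfer _ _ _ _ _ P W (X j)
  (mscale (NngNum c0) (distribution P (X j))) mW W0 _ _ (EFin \o f j))//.
- rewrite ge0_integral_mscale//; last 2 first.
  + exact/measurable_EFinP.
  + by move=> x _; rewrite lee_fin.
  rewrite ge0_integral_distribution//; last 2 first.
  + exact/measurable_EFinP.
  + by move=> x; rewrite lee_fin.
  congr (_ * _)%E; rewrite /= -prodEFin.
  by apply: eq_bigr => i _.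
- move=> A mA.
  pose fA i := if i == j then \1_A else f i.
  have mfA i : measurable_fun setT (fA i).
    by rewrite /fA; case: ifPn => // _; exact: measurable_indic.
  have fA0 i x : 0 <= fA i x by rewrite /fA; case: ifPn.
  have PA : (\int[P]_w (fA j (X j w))%:E = P (X j @^-1` A))%E.
    rewrite /fA eqxx -[X in P X]setIT -(integral_indic P measurableT)//.
    exact: measurable_funPTI.
  have fAoo i : (\int[P]_w (fA i (X i w))%:E < +oo)%E.
    have [->|ij] := eqVneq i j; last by rewrite /fA (negbTE ij).
    rewrite PA (le_lt_trans (probability_le1 P _)) ?ltry//.
    exact: measurable_funPTI.
  have fA_ind i : i \notin s -> exists2 B, measurable B & fA i = \1_B.
    move=> si; rewrite /fA; have [_|ij] := eqVneq i j; first by exists A.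
    by apply: find; rewrite inE negb_or ij.
  have := IHs fA mfA fA0 fAoo fA_ind.
  rewrite [RHS](bigD1 j)//= PA => IH.
  rewrite integral_mkcond epatch_indic /mscale/= muleC.
  transitivity (\int[P]_w (\prod_i fA i (X i w))%:E)%E.
    apply: eq_integral => w _; rewrite (bigD1 j)//= -EFinM mulrC.
    rewrite /fA eqxx; congr (_ * _)%:E.
    by apply: eq_bigr => i /negbTE ->.
  rewrite IH; congr (_ * _)%E; rewrite -prodEFin.
  by apply: eq_bigr => i /negbTE ij; rewrite -fin_int /fA ij.
- exact/measurable_EFinP.
- by move=> x; rewrite lee_fin.
Qed.

(** * Tilting a gamma law *)

Section gamma_distribution.
Context (R : realType).
Implicit Types (k : nat) (theta u t : R).

Lemma Gamma_fun_ge0 (a : R) : 0 <= Gamma_fun a.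
Proof.
by apply: Rintegral_ge0 => t _; rewrite mulr_ge0 ?powR_ge0 ?expR_ge0.
Qed.

Lemma gamma_pdf_ge0 k theta t : 0 <= theta -> 0 <= gamma_pdf k theta t.
Proof.
move=> theta0; rewrite /gamma_pdf indicE.
have [|_] := boolP (t \in _); last by rewrite mulr0.
rewrite inE/= in_itv/= andbT => t0.
by rewrite !mulr_ge0 ?expR_ge0 ?exprn_ge0 ?invr_ge0 ?Gamma_fun_ge0.
Qed.

Lemma measurable_gamma_pdf k theta :
  measurable_fun setT (gamma_pdf k theta : R -> R).
Proof.
apply: measurable_funM; last exact: measurable_indic.
apply: measurable_funM.
  by do 2 apply: measurable_funM => //; exact: measurable_funX.
apply: measurableT_comp => //; exact: measurable_funM.
Qed.

(** The exponential factor turns [e^(-theta t)] into [e^(-(theta + u) t)], and the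
power of the rate is adjusted accordingly. *)
Lemma gamma_pdf_tilt k theta u t : 0 < theta -> 0 <= u ->
  expR (- u * t) * gamma_pdf k theta t =
  (theta / (theta + u)) ^+ k * gamma_pdf k (theta + u) t.
Proof.
move=> theta0 u0; have tu0 : 0 < theta + u by rewrite ltr_wpDr.
rewrite /gamma_pdf expr_div_n.
have -> : expR (- (theta + u) * t) = expR (- theta * t) * expR (- u * t).
  by rewrite -expRD; congr expR; ring.
(* the normalisation constant is the same on both sides *)
move: (Gamma_fun _)^-1 => g.
by field; rewrite expf_neq0// gt_eqF.
Qed.

Lemma gamma_law_tilt k theta u d (T : measurableType d) (P : probability T R)
    (X : {RV P >-> R}) :
  0 < theta -> 0 <= u ->
  (forall A : set R, measurable A -> distribution P X A = gamma_law k theta A) ->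
  forall A, measurable A ->
  (\int[P]_w (expR (- u * X w) * \1_A (X w))%:E =
   ((theta / (theta + u)) ^+ k)%:E * gamma_law k (theta + u) A)%E.
Proof.
move=> theta0 u0 lawX A mA.
have mg : measurable_fun setT (fun x : R => (expR (- u * x) * \1_A x)%:E).
  apply/measurable_EFinP; apply: measurable_funM => //.
  by apply: measurableT_comp => //; exact: measurable_funM.
have g0 (x : R) : (0 <= (expR (- u * x) * \1_A x)%:E)%E.
  by rewrite lee_fin mulr_ge0 ?expR_ge0.
rewrite -[LHS](ge0_integral_distribution X mg g0).
rewrite -(@tilted_transfer _ _ (measurableTypeR R) R _ lebesgue_measure
  (gamma_pdf k theta) id (distribution P X))//; last 3 first.
- exact: measurable_gamma_pdf.
- by move=> t; exact/gamma_pdf_ge0/ltW.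
- by move=> B mB; rewrite [RHS]lawX.
have mpdf : measurable_fun setT (fun t => (gamma_pdf k (theta + u) t)%:E).
  apply/measurable_EFinP. exact: measurable_gamma_pdf.
rewrite /gamma_law -ge0_integralZl//; last 3 first.
- exact: measurable_funTS.
- by move=> t _; rewrite lee_fin gamma_pdf_ge0// addr_ge0// ltW.
- by rewrite lee_fin exprn_ge0// divr_ge0// ?addr_ge0// ltW.
rewrite [RHS]integral_mkcond epatch_indic.
apply: eq_integral => t _; rewrite /= -!EFinM -gamma_pdf_tilt//.
by congr (_%:E); ring.
Qed.
End gamma_distribution.

(** * Change of rate for a gamma sample *)

Section sample_law.
Context d (T : measurableType d) (R : realType) (P : probability T R) (m : nat).
Variable X : 'I_m -> {RV P >-> R}.

Lemma measurable_sample : measurable_fun setT (sample X).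
Proof.
apply/measurable_fun_tnthP => i.
rewrite (_ : _ \o _ = X i)//.
by apply/funext => w; rewrite /= tnth_mktuple.
Qed.

HB.instance Definition _ := isMeasurableFun.Build _ _ _ _ (sample X)
  measurable_sample.

End sample_law.

Definition box (R : realType) m (A : 'I_m -> set R) : set (m.-tuple R) :=
  [set x | forall i, A i (tnth x i)].

Definition boxes (R : realType) m : set (set (m.-tuple R)) :=
  [set box A | A in [set A | forall i, measurable (A i)]].

Section boxes.
Context (R : realType) (m : nat).

Lemma measurable_box (A : 'I_m -> set R) :
  (forall i, measurable (A i)) -> measurable (box A).
Proof.
move=> mA; rewrite (_ : box A =
    \bigcap_(i in [set: 'I_m]) ((fun x => tnth x i) @^-1` A i)); last first.
  by apply/seteqP; split=> x /= xA i; [move=> _|]; exact: xA.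
apply: fin_bigcap_measurable => // i _; rewrite -[X in measurable X]setTI.
exact: measurable_tnth.
Qed.

Lemma boxesI : setI_closed (@boxes R m).
Proof.
move=> _ _ [A mA <-] [B mB <-]; exists (fun i => A i `&` B i).
  by move=> i; exact: measurableI.
apply/seteqP; split=> x /=; first by move=> AB; split=> i; case: (AB i).
by move=> [xA xB] i; split.
Qed.

Lemma measurable_tuple_boxes (A : set (m.-tuple R)) :
  measurable A -> <<s @boxes R m >> A.
Proof.
apply: smallest_sub; first exact: smallest_sigma_algebra.
apply: (big_ind (fun G => G `<=` <<s @boxes R m >>)).
- by [].
- by move=> G H Gb Hb B [/Gb|/Hb].
move=> i _ _ [B mB <-]; apply: sub_sigma_algebra.
exists (fun j => if j == i then B else setT).
  by move=> j; case: ifPn.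
apply/seteqP; split => x /=.
  by move=> /(_ i); rewrite eqxx.
by move=> [_ Bx] j; case: ifPn => // /eqP ->.
Qed.

End boxes.

Section change_of_rate.
Local Open Scope ereal_scope.
Context (R : realType) (k m : nat) (theta u : R).
Context d (T : measurableType d) (P : probability T R)
  (X : 'I_m -> {RV P >-> R}).
Context d' (T' : measurableType d') (P' : probability T' R)
  (X' : 'I_m -> {RV P' >-> R}).
Hypotheses (theta0 : (0 < theta)%R) (u0 : (0 <= u)%R).
Hypothesis iidX : iid_gamma P k theta X.
Hypothesis iidX' : iid_gamma P' k (theta + u)%R X'.

Local Notation mu := (distribution P (sample X)).
Local Notation mu' := (distribution P' (sample X')).
Let W (x : m.-tuple R) : R := expR (- u * \sum_(i < m) tnth x i).

Let mW : measurable_fun setT W.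
Proof.
apply: measurableT_comp => //; apply: measurable_funM => //.
by apply: measurable_sum => i; exact: measurable_tnth.
Qed.

Let W0 x : (0 <= W x)%R. Proof. exact: expR_ge0. Qed.

Let c0 : (0 <= (theta / (theta + u)) ^+ (k * m))%R.
Proof. by rewrite exprn_ge0// divr_ge0 ?addr_ge0// ltW. Qed.

Let tilted_box A : (forall i, measurable (A i)) ->
  tilted mu mW W0 (box A) = mscale (NngNum c0) mu' (box A).
Proof.
move=> mA; rewrite /tilted integral_mkcond epatch_indic.
rewrite ge0_integral_distribution; last 2 first.
- apply: emeasurable_funM; first exact/measurable_EFinP.
  by apply/measurable_EFinP; apply: measurable_indic; exact: measurable_box.
- by move=> x; rewrite /= -EFinM lee_fin mulr_ge0.
pose f i x : R := (expR (- u * x) * \1_(A i) x)%R.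
have mf i : measurable_fun setT (f i).
  apply: measurable_funM; last exact: measurable_indic.
  by apply: measurableT_comp => //; exact: measurable_funM.
have f0 i x : (0 <= f i x)%R by rewrite mulr_ge0 ?expR_ge0.
have fE i : \int[P]_w (f i (X i w))%:E =
    ((theta / (theta + u)) ^+ k)%:E * distribution P' (X' i) (A i).
  rewrite (iidX'.2 i _ (mA i)).
  exact: (gamma_law_tilt theta0 u0 (iidX.2 i)).
transitivity (\int[P]_w (\prod_(i < m) f i (X i w))%:E).
  apply: eq_integral => w _; rewrite /= -EFinM; congr (_%:E).
  rewrite /W /f big_split/= -expR_sum mulr_sumr; congr (expR _ * _)%R.
    by apply: eq_bigr => i _; rewrite tnth_mktuple.
  rewrite indicE; have [|] := boolP (_ \in box A).
    rewrite inE => XA; rewrite big1// => i _.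
    by rewrite indicE mem_set//; have := XA i; rewrite tnth_mktuple.
  rewrite notin_setE => /existsNP[i].
  by rewrite tnth_mktuple => XA; rewrite (bigD1 i)//= indicE memNset// mul0r.
rewrite integral_prod_independent//; last 2 first.
- exact: iidX.1.
- move=> i; rewrite fE lte_mul_pinfty ?lee_fin ?exprn_ge0 ?divr_ge0//.
  + exact: ltW.
  + by rewrite addr_ge0// ltW.
  + by rewrite (le_lt_trans (probability_le1 _ (mA i)))// ltry.
under eq_bigr do rewrite fE.
rewrite big_split/= prodEFin prodr_const card_ord -exprM.
congr (_ * _); have := iidX'.1 [set: 'I_m]%SET A mA.
rewrite [in RHS](eq_bigl predT); last by move=> i; rewrite inE.
move=> <-; congr (P' _); apply/seteqP; split=> w /=.
  by move=> XA i; rewrite tnth_mktuple; apply: XA; rewrite /= inE.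
by move=> XA i _; have := XA i; rewrite tnth_mktuple.
Qed.

(** Both sides are integrals against finite measures on the space of samples, and
boxes form a pi-system generating its sigma-algebra; on boxes the identity is
the product of its one-dimensional instances. *)
Lemma change_of_rate (f : m.-tuple R -> \bar R) :
  measurable_fun setT f -> (forall x, 0 <= f x) ->
  \int[mu]_x ((expR (- u * \sum_(i < m) tnth x i))%:E * f x) =
  ((theta / (theta + u)) ^+ (k * m))%:E * \int[mu']_x f x.
Proof.
move=> mf f0.
rewrite -(ge0_integral_tilted mu mW W0)//.
rewrite -[X in X%:E](_ : (NngNum c0)%:num = _)// -ge0_integral_mscale//.
apply: eq_measure_integral => A mA _.
apply: (@g_sigma_algebra_measure_unique _ _ _ (@boxes R m) _ (fun=> setT)).
- by move=> _ [B mB <-]; exact: measurable_box.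
- move=> _; exists (fun=> setT) => //.
  by apply/seteqP; split.
- exact: bigcup_const.
- exact: boxesI.
- by move=> _ [B mB <-]; exact: tilted_box.
- move=> _; have := tilted_box (fun i => measurableT : measurable [set: R]).
  rewrite (_ : box _ = setT)//; last by apply/seteqP; split.
  by move=> /= ->; rewrite /mscale/= probability_setT mule1 ltry.
- exact: measurable_tuple_boxes.
Qed.

End change_of_rate.

(** * Laplace integrals and their mixtures *)

Section calculus.
Import numFieldNormedType.Exports.
Context (R : realType).
Local Notation leb := (@lebesgue_measure R).

Section ftc.
Variables (f F : R -> R).
Hypothesis dF : forall x : R, 0 <= x -> is_derive x 1 F (f x).
Hypothesis cf : forall x : R, 0 <= x -> {for x, continuous f}.

Let cF (x : R) : 0 <= x -> {for x, continuous F}.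
Proof.
move=> x0; apply/differentiable_continuous/derivable1_diffP.
by have [] := dF x0.
Qed.

Let F' (x : R) : 0 <= x -> derive1 F x = f x.
Proof. by move=> x0; rewrite derive1E; have /@derive_val := dF x0. Qed.

Lemma integral_0c_derive a : 0 < a ->
  (\int[leb]_(x in `[0%R, a]) (f x)%:E = (F a - F 0)%:E)%E.
Proof.
move=> a0; rewrite (@continuous_FTC2 _ _ F)//.
- apply/continuous_within_itvP => //; split.
  + by move=> x; rewrite in_itv/= => /andP[/ltW x0 _]; exact: cf.
  + by apply: cvg_at_right_filter; exact: cf.
  + by apply: cvg_at_left_filter; apply: cf; exact: ltW.
- split.
  + by move=> x; rewrite in_itv/= => /andP[/ltW x0 _]; have [] := dF x0.
  + by apply: cvg_at_right_filter; exact: cF.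
  + by apply: cvg_at_left_filter; apply: cF; exact: ltW.
- by move=> x; rewrite in_itv/= => /andP[/ltW x0 _]; exact: F'.
Qed.

Lemma integral_0y_derive l : (forall x : R, 0 <= x -> 0 <= f x) ->
  F x @[x --> +oo] --> l ->
  (\int[leb]_(x in `[0%R, +oo[) (f x)%:E = (l - F 0)%:E)%E.
Proof.
move=> f0 Fl; rewrite (@ge0_continuous_FTC2y _ _ F _ l)//.
- apply/continuous_within_itvcyP => //; split.
  + by move=> x; rewrite in_itv/= andbT => /ltW x0; exact: cf.
  + by apply: cvg_at_right_filter; exact: cf.
- by move=> x /ltW x0; have [] := dF x0.
- by apply: cvg_at_right_filter; exact: cF.
- by move=> x; rewrite in_itv/= andbT => /ltW x0; exact: F'.
Qed.

End ftc.


Lemma is_derive_expNM (s u : R) :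
  is_derive u 1 (fun v : R => expR (- v * s)) (- s * expR (- u * s)).
Proof.
rewrite (_ : - s * _ = expR (- u * s) * ((- id) u *: 0 + cst s u *: -1)).
  exact: (@is_derive1_comp R expR (fun v => - v * s) u _ _).
by rewrite /GRing.scale/= mulr0 add0r mulrN1 mulrC.
Qed.

Lemma is_derive_continuous (f : R -> R) (x df : R) :
  is_derive x 1 f df -> {for x, continuous f}.
Proof.
by case=> + _ => /derivable1_diffP/differentiable_continuous.
Qed.

Lemma is_derive_scale (c : R) (f : R -> R) (x df df' : R) :
  is_derive x 1 f df -> c * df = df' -> is_derive x 1 (fun v => c * f v) df'.
Proof. by move=> dfx <-; exact: (is_deriveZ c dfx). Qed.

Lemma integral_0c_expNM (s a : R) : 0 < s -> 0 < a ->
  (\int[leb]_(u in `[0%R, a]) (expR (- u * s))%:E =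
   ((1 - expR (- a * s)) / s)%:E)%E.
Proof.
move=> s0 a0.
have dF (x : R) : 0 <= x ->
    is_derive x 1 (fun u => - s^-1 * expR (- u * s)) (expR (- x * s)).
  move=> _; apply: is_derive_scale (is_derive_expNM s x) _.
  by field; rewrite gt_eqF.
rewrite (integral_0c_derive dF)//.
- by congr (_%:E); rewrite oppr0 mul0r expR0; ring.
- by move=> x _; exact: is_derive_continuous (is_derive_expNM s x).
Qed.

Lemma integral_0y_expNM (s : R) : 0 < s ->
  (\int[leb]_(u in `[0%R, +oo[) (expR (- u * s))%:E = s^-1%:E)%E.
Proof.
move=> s0.
have dF (x : R) : 0 <= x ->
    is_derive x 1 (fun u => - s^-1 * expR (- u * s)) (expR (- x * s)).
  move=> _; apply: is_derive_scale (is_derive_expNM s x) _.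
  by field; rewrite gt_eqF.
rewrite (@integral_0y_derive _ _ dF _ 0)//.
- by congr (_%:E); rewrite oppr0 mul0r expR0; ring.
- by move=> x _; exact: is_derive_continuous (is_derive_expNM s x).
- rewrite -(mulr0 (- s^-1)); apply: cvgMr.
  rewrite (_ : (fun u => expR (- u * s)) =
    (fun z => expR (- z)) \o (fun u => s * u)); last first.
    by apply/funext => u /=; rewrite mulNr mulrC.
  by apply: cvg_comp; [exact: gt0_cvgMry|exact: cvgr_expR].
Qed.

(** With the convention [0^-1 = 0], [x^-1 = x * e^(-ln x^2)] for every real [x]. *)
Lemma measurable_fun_inv d (T : measurableType d) (f : T -> R) :
  measurable_fun setT f -> measurable_fun setT (fun x => (f x)^-1).
Proof.
move=> mf.
rewrite (_ : (fun x => _) = fun x => f x * expR (- ln (f x ^+ 2))); last first.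
  apply/funext => x; have [->|fx0] := eqVneq (f x) 0; first by rewrite mul0r invr0.
  have fx2 : 0 < f x ^+ 2 by rewrite exprn_even_gt0.
  by rewrite expRN lnK ?posrE//; field.
apply: measurable_funM => //; apply: measurableT_comp => //.
apply: measurable_funN; apply: measurableT_comp; first exact: measurable_ln.
exact: measurable_funX.
Qed.

Section ratio.
Variable theta : R.
Hypothesis theta0 : 0 < theta.

Let tu_gt0 u : 0 <= u -> 0 < theta + u.
Proof. by move=> u0; rewrite ltr_wpDr. Qed.

Let is_derive_tu (u : R) : is_derive u 1 (fun v : R => theta + v) 1.
Proof.
rewrite -[X in is_derive _ _ _ X](add0r (1 : R)).
exact: (is_deriveD (is_derive_cst theta u 1) (is_derive_id u 1)).
Qed.

Let is_derive_ratioX (u : R) p : 0 <= u ->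
  is_derive u 1 (fun v : R => (theta / (theta + v)) ^+ p.+1)
    (- (p.+1%:R / theta) * (theta / (theta + u)) ^+ p.+2).
Proof.
move=> u0; have tu0 : theta + u != 0 by rewrite gt_eqF ?tu_gt0.
have dV := is_deriveV tu0 (is_derive_tu u).
rewrite (_ : (fun v => _) =
  (cst theta * (fun y : R => (theta + y)^-1)) ^+ p.+1); last first.
  by apply/funext => v; rewrite fctE.
rewrite (_ : _ * _ ^+ p.+2 = (p.+1%:R * (theta / (theta + u)) ^+ p) *:
  (theta *: (- (theta + u) ^- 2 *: 1) + (theta + u)^-1 *: 0)).
  exact: (is_deriveX p.+1 (is_deriveM (is_derive_cst theta u 1) dV)).
rewrite /GRing.scale/= !exprS; field.
by rewrite tu0 gt_eqF.
Qed.

Let continuous_ratioX (u : R) p : 0 <= u ->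
  {for u, continuous (fun v : R => (theta / (theta + v)) ^+ p.+1)}.
Proof. by move=> u0; exact: is_derive_continuous (is_derive_ratioX p u0). Qed.

Lemma measurable_ratio : measurable_fun setT (fun u : R => theta / (theta + u)).
Proof.
by apply: measurable_funM => //; apply: measurable_fun_inv; exact: measurable_funD.
Qed.

Lemma cvg_integral_0n_ratioX p :
  (\int[leb]_(u in `[0%R, n%:R]) ((theta / (theta + u)) ^+ p)%:E @[n --> \oo] -->
   \int[leb]_(u in `[0%R, +oo[) ((theta / (theta + u)) ^+ p)%:E)%E.
Proof.
(* the absolute value makes the integrand nonnegative on the whole line *)
have abs (i : interval R) : [set` i] `<=` `[0, +oo[%classic ->
    (\int[leb]_(u in [set` i]) ((theta / (theta + u)) ^+ p)%:E =
     \int[leb]_(u in [set` i]) ((theta / (theta + `|u|)) ^+ p)%:E)%E.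
  move=> i0; apply: eq_integral => u; rewrite inE => /i0/=.
  by rewrite in_itv/= andbT => u0; rewrite ger0_norm.
rewrite abs//.
under [X in X @ _ --> _]eq_fun => n do rewrite (abs _ (subset_itvl _))//.
apply: ge0_cvgn_integral; last first.
  apply: measurable_funX; apply: (measurableT_comp measurable_ratio).
  exact: normr_measurable.
by move=> u; rewrite exprn_ge0// divr_ge0// ltW// tu_gt0.
Qed.

Lemma integral_0y_ratioX p :
  (\int[leb]_(u in `[0%R, +oo[) ((theta / (theta + u)) ^+ p.+2)%:E =
   (theta / p.+1%:R)%:E)%E.
Proof.
pose F u := - (theta / p.+1%:R) * (theta / (theta + u)) ^+ p.+1.
have dF (x : R) : 0 <= x -> is_derive x 1 F ((theta / (theta + x)) ^+ p.+2).
  move=> x0; apply: is_derive_scale (is_derive_ratioX p x0) _.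
  rewrite !exprS; field.
  by rewrite !gt_eqF ?tu_gt0.
rewrite (@integral_0y_derive _ F dF _ 0)//.
- congr (_%:E); rewrite /F addr0 divff ?gt_eqF// expr1n; ring.
- by move=> x x0; exact: continuous_ratioX.
- by move=> x x0; rewrite exprn_ge0// divr_ge0// ltW// tu_gt0.
- rewrite -(mulr0 (- (theta / p.+1%:R))); apply: cvgMr.
  rewrite [X in _ --> X](_ : 0 = (0 : R) ^+ p.+1); last by rewrite expr0n.
  apply: (@cvg_comp _ _ _ _ (fun z : R => z ^+ p.+1) _ (nbhs (0 : R)));
    last exact: exprn_continuous.
  rewrite -(mulr0 theta); apply: cvgMr.
  apply/gtr0_cvgV0.
    near=> u; apply: tu_gt0.
    by near: u; apply: nbhs_pinfty_ge; rewrite num_real.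
  apply/cvgryPge => M; near=> u.
  rewrite -lerBlDl; by near: u; apply: nbhs_pinfty_ge; rewrite num_real.
Unshelve. all: by end_near. Qed.

Lemma integral_0y_ratio :
  (\int[leb]_(u in `[0%R, +oo[) (theta / (theta + u))%:E = +oo)%E.
Proof.
apply/eqyP => M M0.
have e0 : 0 < expR (M / theta) by exact: expR_gt0.
(* chosen so that [theta * ln (a / theta) = M] *)
pose a := theta * expR (M / theta).
have a0 : 0 < a by rewrite mulr_gt0.
have dF (x : R) : 0 <= x ->
    is_derive x 1 (fun u => theta * ln (theta + u)) (theta / (theta + x)).
  move=> x0; have tx := is_derive1_ln (tu_gt0 x0).
  apply: is_derive_scale (is_derive1_comp tx (is_derive_tu x)) _.
  by rewrite mulr1.
apply: (@le_trans _ _ (\int[leb]_(u in `[0%R, a]) (theta / (theta + u))%:E)%E).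
  rewrite (integral_0c_derive dF)//; last first.
    by move=> x x0; exact: (@continuous_ratioX x 0 x0).
  rewrite lee_fin -mulrBr addr0 -ln_div ?posrE ?tu_gt0// ?(ltW a0)//.
  rewrite -ler_pdivrMl// [_^-1 * _]mulrC.
  rewrite -(expRK (M / theta)) ler_ln ?posrE ?expR_gt0 ?divr_gt0 ?tu_gt0 ?(ltW a0)//.
  rewrite ler_pdivlMr// /a.
  by rewrite mulrC lerDr ltW.
apply: ge0_subset_integral => //=.
- by apply/measurable_EFinP; apply: measurable_funTS; exact: measurable_ratio.
- by move=> x; rewrite in_itv/= andbT => x0; rewrite lee_fin divr_ge0 ?ltW ?tu_gt0.
- exact: subset_itvl.
Qed.
End ratio.
End calculus.

(** * Means and second moments *)

Section second_moment.
Local Open Scope ereal_scope.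
Context d (T : measurableType d) (R : realType) (P : probability T R).
Variables (Z : T -> R) (r : R).
Hypothesis meanZ : \int[P]_x (Z x)%:E = r%:E.

(** The extended difference [+oo - +oo] is [-oo], so a real mean means that both
parts have a finite one. *)
Lemma mean_parts :
  \int[P]_x (Num.max (- Z x) 0)%:E < +oo /\
  \int[P]_x (Num.max (Z x) 0)%:E = \int[P]_x (Num.max (- Z x) 0)%:E + r%:E.
Proof.
move: meanZ; rewrite integralE.
have -> : \int[P]_x (EFin \o Z)^\+ x = \int[P]_x (Num.max (Z x) 0)%:E.
  by apply: eq_integral => x _; rewrite funeposE/= -EFin_max.
have -> : \int[P]_x (EFin \o Z)^\- x = \int[P]_x (Num.max (- Z x) 0)%:E.
  by apply: eq_integral => x _; rewrite funenegE/= -EFin_max.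
move=> E; have : r%:E \is a fin_num by [].
rewrite -E fin_numB => /andP[fp fq]; split; first by rewrite ltey_eq fq.
by rewrite addeC subeK.
Qed.

(** Bias-variance identity, valid also when the second moment is infinite: the
expansion of the square is integrated with its terms moved to the sides where
they are nonnegative. *)
Lemma second_moment_shift : measurable_fun setT Z -> (0 <= r)%R ->
  \int[P]_x ((Z x - r) ^+ 2)%:E + (r ^+ 2)%:E = \int[P]_x (Z x ^+ 2)%:E.
Proof.
move=> mZ r0; have [negoo posE] := mean_parts.
pose pos x : R := Num.max (Z x) 0%R; pose neg x : R := Num.max (- Z x)%R 0%R.
have pos0 x : (0 <= pos x)%R by rewrite le_max lexx orbT.
have neg0 x : (0 <= neg x)%R by rewrite le_max lexx orbT.
have mpos : measurable_fun setT pos by exact: measurable_maxr.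
have mneg : measurable_fun setT neg.
  by apply: measurable_maxr => //; exact: measurable_funN.
have mZr : measurable_fun setT (fun x => (Z x - r) ^+ 2)%R.
  by apply: measurable_funX; exact: measurable_funB.
have mZ2 : measurable_fun setT (fun x => Z x ^+ 2)%R by exact: measurable_funX.
pose E (f : T -> R) := \int[P]_x (f x)%:E.
have ED (f g : T -> R) : measurable_fun setT f -> measurable_fun setT g ->
    (forall x, (0 <= f x)%R) -> (forall x, (0 <= g x)%R) ->
    E (fun x => f x + g x)%R = E f + E g.
  exact: integralD_ge0_real.
have EZ (c : R) (f : T -> R) : (0 <= c)%R -> measurable_fun setT f ->
    (forall x, (0 <= f x)%R) -> E (fun x => c * f x)%R = c%:E * E f.
  exact: integralZl_ge0_real.
have r20 : (0 <= 2 * r)%R by rewrite mulr_ge0.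
have : E (fun x => (Z x - r) ^+ 2 + 2 * r * pos x)%R =
       E (fun x => (Z x ^+ 2 + r ^+ 2) + 2 * r * neg x)%R.
  apply: eq_integral => x _; congr (_%:E); rewrite /pos /neg.
  case: (leP 0%R (Z x)) => Zx0.
    by rewrite max_r ?oppr_le0//; ring.
  by rewrite max_l ?oppr_ge0 ?ltW//; ring.
rewrite ED//; last 3 first.
- exact: measurable_funM.
- by move=> x; rewrite sqr_ge0.
- by move=> x; rewrite mulr_ge0.
rewrite ED//; last 4 first.
- exact: measurable_funD.
- exact: measurable_funM.
- by move=> x; rewrite addr_ge0 ?sqr_ge0.
- by move=> x; rewrite mulr_ge0.
rewrite ED//; last 2 first.
- by move=> x; rewrite sqr_ge0.
- by move=> x; rewrite sqr_ge0.
rewrite (EZ _ pos)// (EZ _ neg)//.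
have -> : E (fun=> r ^+ 2)%R = (r ^+ 2)%:E.
  by rewrite /E integral_cst// [X in _ * X]probability_setT mule1.
rewrite [E pos]posE -/(E neg).
have negfin : E neg \is a fin_num.
  by rewrite ge0_fin_numE//; exact: integral_ge0_real.
rewrite -/(E (fun x => (Z x - r) ^+ 2)%R) -/(E (fun x => Z x ^+ 2)%R).
have : 0 <= E (fun x => (Z x - r) ^+ 2)%R.
  by apply: integral_ge0_real => x; rewrite sqr_ge0.
have : 0 <= E (fun x => Z x ^+ 2)%R.
  by apply: integral_ge0_real => x; rewrite sqr_ge0.
move: (E (fun x => Z x ^+ 2)%R) (E (fun x => (Z x - r) ^+ 2)%R).
move=> [a| |] [b| |]//= _ _; rewrite -(fineK negfin).
- by rewrite -!(EFinM, EFinD) => -[] H; congr (_%:E); lra.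
- by rewrite -!(EFinM, EFinD).
- by rewrite -!(EFinM, EFinD).
Qed.

End second_moment.

(** * Unbiased estimation of a rate *)

(** The hypothesis [change_rate] captures what a gamma sample contributes: [T] is
almost surely the sum of the sample, and [p + 2] is [k * m]. *)
Section rate_family.
Local Open Scope ereal_scope.
Context d (Y : measurableType d) (R : realType).
Variables (nu : R -> probability Y R) (T : Y -> R) (p : nat).
Hypotheses (mT : measurable_fun setT T) (T0 : forall y, (0 < T y)%R).
Hypothesis change_rate : forall (theta u : R) (f : Y -> \bar R),
  (0 < theta)%R -> (0 <= u)%R ->
  measurable_fun setT f -> (forall y, 0 <= f y) ->
  \int[nu theta]_y ((expR (- u * T y))%:E * f y) =
  ((theta / (theta + u)) ^+ p.+2)%:E * \int[nu (theta + u)%R]_y f y.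
Local Notation leb := (@lebesgue_measure R).

Lemma integral_mixture (theta : R) (D : set R) (f : Y -> \bar R) :
  (0 < theta)%R -> measurable D -> D `<=` `[0%R, +oo[%classic ->
  measurable_fun setT f -> (forall y, 0 <= f y) ->
  \int[nu theta]_y (f y * \int[leb]_(u in D) (expR (- u * T y))%:E) =
  \int[leb]_(u in D)
    (((theta / (theta + u)) ^+ p.+2)%:E * \int[nu (theta + u)%R]_y f y).
Proof.
move=> theta0 mD D0 mf f0.
pose g (z : Y * measurableTypeR R) : \bar R :=
  f z.1 * (expR (- z.2 * T z.1) * \1_D z.2)%:E.
have mg : measurable_fun setT g.
  apply: emeasurable_funM; first exact: measurableT_comp.
  apply/measurable_EFinP; apply: measurable_funM.
    apply: measurableT_comp => //; apply: measurable_funM.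
      by apply: measurable_funN; exact: measurable_snd.
    exact: measurableT_comp.
  exact: measurableT_comp (measurable_indic mD) measurable_snd.
have g0 z : 0 <= g z by rewrite mule_ge0// lee_fin mulr_ge0// expR_ge0.
transitivity (\int[nu theta]_y \int[leb]_u g (y, u)).
  apply: eq_integral => y _; rewrite /g/= ge0_integralZl//.
  - by rewrite [in LHS]integral_mkcond epatch_indic.
  - apply/measurable_EFinP; apply: measurable_funM; last exact: measurable_indic.
    by apply: measurableT_comp => //; apply: measurable_funM.
rewrite (@fubini_tonelli _ _ _ _ _ (nu theta) leb g mg g0) [RHS]integral_mkcond.
apply: eq_integral => u _; rewrite patchE; case: ifPn => [uD|uD]; last first.
  by rewrite integral0_eq// => y _; rewrite /g/= indicE (negbTE uD) mulr0 mule0.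
have u0 : (0 <= u)%R.
  by have := D0 _ (set_mem uD); rewrite /= in_itv/= andbT.
rewrite -change_rate//; apply: eq_integral => y _.
by rewrite /g/= indicE uD mulr1 muleC.
Qed.

(** Mixing over the whole half-line, with [1/T] the Laplace integral and [f = 1]. *)
Lemma expectation_inv (theta : R) : (0 < theta)%R ->
  \int[nu theta]_y ((T y)^-1)%:E = (theta / p.+1%:R)%:E.
Proof.
move=> theta0; rewrite -(integral_0y_ratioX theta0).
transitivity (\int[nu theta]_y
    (1 * \int[leb]_(u in `[0%R, +oo[) (expR (- u * T y))%:E)).
  by apply: eq_integral => y _; rewrite mul1e integral_0y_expNM.
rewrite integral_mixture//; apply: eq_integral => u _.
by rewrite integral_cst// mul1e [X in _ * X]probability_setT mule1.
Qed.

(** The mixture identity for [f = 1/T], whose means are now known at every rate. *)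
Lemma expectation_inv_laplace (theta : R) (D : set R) :
  (0 < theta)%R -> measurable D -> D `<=` `[0%R, +oo[%classic ->
  \int[nu theta]_y (((T y)^-1)%:E * \int[leb]_(u in D) (expR (- u * T y))%:E) =
  (theta / p.+1%:R)%:E * \int[leb]_(u in D) ((theta / (theta + u)) ^+ p.+1)%:E.
Proof.
move=> theta0 mD D0.
rewrite integral_mixture//; last 2 first.
- by apply/measurable_EFinP; exact: measurable_fun_inv.
- by move=> y; rewrite lee_fin invr_ge0 ltW.
have mratio : measurable_fun D (fun u : R => ((theta / (theta + u)) ^+ p.+1)%:E).
  apply/measurable_EFinP; apply: measurable_funX.
  by apply: measurable_funTS; exact: measurable_ratio.
have ratio0 (u : R) : D u -> 0 <= ((theta / (theta + u)) ^+ p.+1)%:E.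
  move=> /D0/=; rewrite in_itv/= andbT => u0.
  by rewrite lee_fin exprn_ge0// divr_ge0 ?addr_ge0// ltW.
have c0 : 0 <= (theta / p.+1%:R)%:E by rewrite lee_fin divr_ge0// ltW.
rewrite -(ge0_integralZl leb mD mratio ratio0 c0).
apply: eq_integral => u /set_mem/D0/=; rewrite in_itv/= andbT => u0.
have tu0 : (0 < theta + u)%R by rewrite ltr_wpDr.
rewrite expectation_inv// -!EFinM; congr (_%:E).
by rewrite !exprS; field; rewrite nat1r pnatr_eq0 gt_eqF.
Qed.

(** For [p = 0] both sides are [+oo]. *)
Lemma integral_0y_ratio_inve (theta : R) : (0 < theta)%R ->
  \int[leb]_(u in `[0%R, +oo[) ((theta / (theta + u)) ^+ p.+1)%:E =
  theta%:E / p%:R%:E.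
Proof.
move=> theta0; case: p => [|q].
  rewrite inve0 gt0_muley; last by rewrite lte_fin.
  by rewrite -(integral_0y_ratio theta0).
by rewrite integral_0y_ratioX// inver pnatr_eq0.
Qed.

Lemma expectation_inv2 (theta : R) : (0 < theta)%R ->
  \int[nu theta]_y ((T y)^-1 ^+ 2)%:E =
  (theta / p.+1%:R)%:E * (theta%:E / p%:R%:E).
Proof.
move=> theta0; rewrite -integral_0y_ratio_inve//.
rewrite -expectation_inv_laplace//; apply: eq_integral => y _.
by rewrite integral_0y_expNM// expr2 EFinM.
Qed.

(** The integral of [e^(-u T)] over [u] in [[0, a]]. *)
Let h (a : R) y := ((1 - expR (- a * T y)) / T y)%R.

Let mh a : measurable_fun setT (h a).
Proof.
apply: measurable_funM; last exact: measurable_fun_inv.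
apply: measurable_funB => //; apply: measurableT_comp => //.
exact: measurable_funM.
Qed.

Let hE a y : (0 < a)%R ->
  \int[leb]_(u in `[0%R, a]) (expR (- u * T y))%:E = (h a y)%:E.
Proof. by move=> a0; rewrite integral_0c_expNM. Qed.

Let h_ge0 a y : (0 < a)%R -> (0 <= h a y)%R.
Proof.
move=> a0; rewrite divr_ge0// ?subr_ge0; last exact: ltW.
by rewrite -expR0 ler_expR mulNr oppr_le0 mulr_ge0// ltW.
Qed.

Let h_le_inv a y : (h a y <= (T y)^-1)%R.
Proof.
by rewrite -[leRHS]mul1r ler_wpM2r ?invr_ge0 ?(ltW (T0 y))// gerBl expR_ge0.
Qed.

Let h_le a y : (h a y <= a)%R.
Proof.
rewrite ler_pdivrMr// lerBlDr -lerBlDl.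
by have := expR_ge1Dx (- a * T y); rewrite mulNr.
Qed.

(** [xi] and [(p + 1) / T] have the same means at all rates, hence the same
correlation with [h a]; a Cauchy-Schwarz argument then bounds it. *)
Let partial_bound (xi : Y -> R) (theta a : R) :
  (0 < theta)%R -> (0 < a)%R -> measurable_fun setT xi ->
  (forall t : R, (0 < t)%R -> \int[nu t]_y (xi y)%:E = t%:E) ->
  (p.+1%:R ^+ 2)%:E * \int[nu theta]_y ((T y)^-1 * h a y)%:E <=
  \int[nu theta]_y (xi y ^+ 2)%:E.
Proof.
move=> theta0 a0 mxi unb.
pose pos y : R := Num.max (xi y) 0%R; pose neg y : R := Num.max (- xi y)%R 0%R.
have pos0 y : (0 <= pos y)%R by rewrite le_max lexx orbT.
have neg0 y : (0 <= neg y)%R by rewrite le_max lexx orbT.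
have mpos : measurable_fun setT pos by exact: measurable_maxr.
have mneg : measurable_fun setT neg.
  by apply: measurable_maxr => //; exact: measurable_funN.
have mTV : measurable_fun setT (fun y => (T y)^-1)%R.
  exact: measurable_fun_inv.
have TV0 y : (0 <= (T y)^-1)%R by rewrite invr_ge0 ltW.
pose c : R := p.+1%:R.
have c0 : (0 <= c)%R by [].
(* unbiasedness, written between nonnegative functions for [integral_mixture] *)
have mean_eq (t : R) : (0 < t)%R ->
    \int[nu t]_y (pos y)%:E = \int[nu t]_y (neg y + c * (T y)^-1)%:E.
  move=> t0; have [_ ->] := mean_parts (unb t t0).
  rewrite integralD_ge0_real//; last 2 first.
  - exact: measurable_funM.
  - by move=> y; rewrite mulr_ge0.
  rewrite integralZl_ge0_real//; congr (_ + _).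
  by rewrite expectation_inv// -EFinM mulrCA divff ?mulr1// pnatr_eq0.
have Eh : \int[nu theta]_y (pos y * h a y)%:E =
    \int[nu theta]_y ((neg y + c * (T y)^-1) * h a y)%:E.
  have mix (f : Y -> R) : measurable_fun setT f -> (forall y, (0 <= f y)%R) ->
      \int[nu theta]_y (f y * h a y)%:E = \int[leb]_(u in `[0%R, a])
        (((theta / (theta + u)) ^+ p.+2)%:E * \int[nu (theta + u)%R]_y (f y)%:E).
    move=> mf f0.
    have D0 : `[0%R, a]%classic `<=` `[0%R, +oo[%classic by exact: subset_itvl.
    have mfE : measurable_fun setT (EFin \o f) by exact/measurable_EFinP.
    have f0E y : 0 <= (EFin \o f) y by rewrite lee_fin.
    rewrite -(integral_mixture theta0 _ D0 mfE f0E)//.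
    by apply: eq_integral => y _; rewrite EFinM hE.
  rewrite !mix//.
  - apply: eq_integral => u; rewrite inE/= in_itv/= => /andP[u0 _].
    by rewrite mean_eq// ltr_wpDr.
  - by apply: measurable_funD => //; exact: measurable_funM.
  - by move=> y; rewrite addr_ge0// mulr_ge0.
pose E (f : Y -> R) := \int[nu theta]_y (f y)%:E.
have ED (f g : Y -> R) : measurable_fun setT f -> measurable_fun setT g ->
    (forall y, (0 <= f y)%R) -> (forall y, (0 <= g y)%R) ->
    E (fun y => f y + g y)%R = E f + E g.
  exact: integralD_ge0_real.
have EZ (r : R) (f : Y -> R) : (0 <= r)%R -> measurable_fun setT f ->
    (forall y, (0 <= f y)%R) -> E (fun y => r * f y)%R = r%:E * E f.
  exact: integralZl_ge0_real.
have E_le (f g : Y -> R) : measurable_fun setT f -> measurable_fun setT g ->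
    (forall y, (0 <= f y)%R) -> (forall y, (f y <= g y)%R) -> E f <= E g.
  exact: le_integral_ge0_real.
have E_ge0 (f : Y -> R) : (forall y, (0 <= f y)%R) -> 0 <= E f.
  exact: integral_ge0_real.
have Eh_fin (f : Y -> R) : measurable_fun setT f -> (forall y, (0 <= f y)%R) ->
    E f < +oo -> E (fun y => f y * h a y)%R \is a fin_num.
  move=> mf f0 foo; rewrite ge0_fin_numE; last first.
    by apply: E_ge0 => y; rewrite mulr_ge0// h_ge0.
  apply: (@le_lt_trans _ _ (E (fun y => a * f y)%R)).
    apply: E_le => [|||y]; first exact: measurable_funM.
    - exact: measurable_funM.
    - by move=> y; rewrite mulr_ge0// h_ge0.
    - by rewrite mulrC ler_wpM2r.
  by rewrite EZ// ?(ltW a0)// lte_mul_pinfty// lee_fin ltW.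
have h0 y : (0 <= h a y)%R by exact: h_ge0.
have mposh : measurable_fun setT (fun y => pos y * h a y)%R.
  exact: measurable_funM.
have mnegh : measurable_fun setT (fun y => neg y * h a y)%R.
  exact: measurable_funM.
have mTVh : measurable_fun setT (fun y => (T y)^-1 * h a y)%R.
  exact: measurable_funM.
have mxi2 : measurable_fun setT (fun y => xi y ^+ 2)%R.
  exact: measurable_funX.
pose B := E (fun y => (T y)^-1 * h a y)%R.
pose Q := E (fun y => neg y * h a y)%R.
pose V := E (fun y => xi y ^+ 2)%R.
have Bfin : B \is a fin_num.
  by apply: Eh_fin => //; rewrite /E expectation_inv// ltry.
have Qfin : Q \is a fin_num.
  by apply: Eh_fin => //; have [] := mean_parts (unb theta theta0).
have V0 : 0 <= V by apply: E_ge0 => y; rewrite sqr_ge0.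
have posh0 y : (0 <= pos y * h a y)%R by rewrite mulr_ge0.
have negh0 y : (0 <= neg y * h a y)%R by rewrite mulr_ge0.
have TVh0 y : (0 <= (T y)^-1 * h a y)%R by rewrite mulr_ge0.
have mcTVh (r : R) : measurable_fun setT (fun y => r * ((T y)^-1 * h a y))%R.
  exact: measurable_funM.
have Eh' : E (fun y => pos y * h a y)%R = Q + c%:E * B.
  rewrite /Q /B -EZ// -ED//; last by move=> y; rewrite mulr_ge0.
  by apply: etrans Eh _; apply: eq_integral => y _; congr (_%:E); ring.
have c20 : (0 <= 2 * c)%R by rewrite mulr_ge0.
have cc0 : (0 <= c ^+ 2)%R by rewrite sqr_ge0.
(* the expectation of [2 xi b <= xi^2 + b^2] at [b = c * h a], with [h a <= 1/T] *)
have ineq : (2 * c)%:E * (Q + c%:E * B) <=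
    V + (c ^+ 2)%:E * B + (2 * c)%:E * Q.
  have m1 : measurable_fun setT (fun y => 2 * c * (neg y * h a y))%R.
    exact: measurable_funM.
  rewrite -Eh' /Q /B /V -!EZ// -ED//; last 2 first.
  - by move=> y; rewrite sqr_ge0.
  - by move=> y; rewrite mulr_ge0.
  rewrite -ED//; last 3 first.
  - exact: measurable_funD.
  - by move=> y; rewrite addr_ge0 ?sqr_ge0// mulr_ge0.
  - by move=> y; rewrite mulr_ge0.
  apply: E_le => [|||y].
  - exact: measurable_funM.
  - by apply: measurable_funD => //; exact: measurable_funD.
  - by move=> y; rewrite mulr_ge0.
  - have : (c ^+ 2 * h a y ^+ 2 <= c ^+ 2 * ((T y)^-1 * h a y))%R.
      by rewrite ler_wpM2l// expr2 ler_wpM2r.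
    have := sqr_ge0 (xi y - c * h a y)%R.
    have := sqr_ge0 (xi y); have := h0 y.
    rewrite /pos /neg; case: (leP 0%R (xi y)) => xi0.
      by rewrite max_r ?oppr_le0//; nra.
    have nxi0 : (0 <= - xi y)%R by rewrite oppr_ge0 ltW.
    have := sqr_ge0 (c * h a y)%R; have := mulr_ge0 nxi0 (mulr_ge0 c0 (h0 y)).
    by rewrite max_l//; nra.
change ((c ^+ 2)%:E * B <= V).
have [->|Voo] := eqVneq V +oo; first by rewrite leey.
have Vfin : V \is a fin_num by rewrite ge0_fin_numE// ltey.
move: ineq; rewrite -(fineK Bfin) -(fineK Qfin) -(fineK Vfin).
by rewrite -!(EFinM, EFinD) !lee_fin; lra.
Qed.

(** Limit of the previous bound: the expectations of [h a / T] are integrals over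
[[0, a]] of a fixed nonnegative function. *)
Lemma unbiased_second_moment_ge (xi : Y -> R) (theta : R) :
  (0 < theta)%R -> measurable_fun setT xi ->
  (forall t : R, (0 < t)%R -> \int[nu t]_y (xi y)%:E = t%:E) ->
  \int[nu theta]_y ((p.+1%:R / T y) ^+ 2)%:E <= \int[nu theta]_y (xi y ^+ 2)%:E.
Proof.
move=> theta0 mxi unb.
have mTV : measurable_fun setT (fun y => (T y)^-1)%R.
  exact: measurable_fun_inv.
under eq_integral do rewrite exprMn.
rewrite integralZl_ge0_real//; last 2 first.
- exact: measurable_funX.
- by move=> y; rewrite sqr_ge0.
rewrite expectation_inv2// -integral_0y_ratio_inve//.
have := @cvg_integral_0n_ratioX R theta theta0 p.+1.
move=> /(cvgeZl (y := (theta / p.+1%:R)%:E) isT).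
move=> /(cvgeZl (y := (p.+1%:R ^+ 2)%:E) isT) cvgJ.
rewrite -(cvg_lim _ cvgJ)//; apply: lime_le; first exact: cvgP cvgJ.
near=> a.
rewrite -expectation_inv_laplace//; last exact: subset_itvl.
have a0 : (0 < a%:R :> R)%R by rewrite ltr0n; near: a; exact: nbhs_infty_gt.
apply: le_trans (partial_bound theta0 a0 mxi unb).
by under eq_integral do rewrite hE// -EFinM.
Unshelve. all: by end_near. Qed.

Theorem mse_scaled_inverse (xi : Y -> R) (theta : R) :
  (0 < theta)%R -> measurable_fun setT xi ->
  (forall t : R, (0 < t)%R -> \int[nu t]_y (xi y)%:E = t%:E) ->
  \int[nu theta]_y ((p.+1%:R / T y - theta) ^+ 2)%:E <=
    \int[nu theta]_y ((xi y - theta) ^+ 2)%:E /\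
  \int[nu theta]_y ((p.+1%:R / T y - theta) ^+ 2)%:E =
    (theta ^+ 2)%:E / p%:R%:E.
Proof.
move=> theta0 mxi unb; have theta0' := ltW theta0.
have mTV : measurable_fun setT (fun y => (T y)^-1)%R.
  exact: measurable_fun_inv.
have mhat : measurable_fun setT (fun y => p.+1%:R / T y)%R.
  exact: measurable_funM.
have hat_mean : \int[nu theta]_y (p.+1%:R / T y)%:E = theta%:E.
  rewrite integralZl_ge0_real//; last by move=> y; rewrite invr_ge0 ltW.
  by rewrite expectation_inv// -EFinM mulrCA divff ?mulr1// pnatr_eq0.
have hat2 : \int[nu theta]_y ((p.+1%:R / T y) ^+ 2)%:E =
    (p.+1%:R ^+ 2)%:E * ((theta / p.+1%:R)%:E * (theta%:E / p%:R%:E)).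
  under eq_integral do rewrite exprMn.
  rewrite integralZl_ge0_real//; last 2 first.
  - exact: measurable_funX.
  - by move=> y; rewrite sqr_ge0.
  by rewrite expectation_inv2.
have hatS := second_moment_shift hat_mean mhat theta0'.
split.
  rewrite -(leeD2rE _ _ (_ : (theta ^+ 2)%:E \is a fin_num))// hatS.
  rewrite (second_moment_shift (unb _ theta0) mxi theta0').
  exact: unbiased_second_moment_ge.
move: hatS; rewrite hat2.
have : 0 <= \int[nu theta]_y ((p.+1%:R / T y - theta) ^+ 2)%:E.
  by apply: integral_ge0_real => y; rewrite sqr_ge0.
move: (\int[nu theta]_y ((p.+1%:R / T y - theta) ^+ 2)%:E) => M M0.
have [->|p0] := eqVneq p 0%N.
  rewrite inve0 !gt0_muley ?lte_fin ?divr_gt0 ?exprn_gt0//.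
  by case: M M0.
have pR0 : (p%:R : R)%R != 0%R by rewrite pnatr_eq0.
rewrite !inver (negbTE pR0) -!EFinM; case: M M0 => // M _ [ME].
congr (_%:E); rewrite (_ : M = M + theta ^+ 2 - theta ^+ 2)%R; last by ring.
by rewrite ME; field; rewrite pR0 nat1r pnatr_eq0.
Qed.

End rate_family.

(** * The sum of a gamma sample *)

Lemma gamma_law_le0 (R : realType) (k : nat) (theta : R) : (2 <= k)%N ->
  gamma_law k theta `]-oo, 0] = 0%E.
Proof.
move=> k2; apply: integral0_eq => t; rewrite /= in_itv/= => t0.
rewrite /gamma_pdf indicE; have [|_] := boolP (t \in _); last by rewrite mulr0.
rewrite inE/= in_itv/= andbT => t0'.
(* at 0 the density vanishes because the power of [t] is positive *)
have -> : t = 0 by apply/eqP; rewrite eq_le t0.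
by case: k k2 => [|[|k]]//= _; rewrite exprS !mul0r.
Qed.

Definition tsum (R : realType) m (x : m.-tuple R) : R := \sum_(i < m) tnth x i.

(** Modified on a null set so as to be positive everywhere. *)
Definition tsum_pos (R : realType) m (x : m.-tuple R) : R :=
  if 0 < tsum x then tsum x else 1.

Section tsum.
Context (R : realType) (m : nat).

Lemma measurable_tsum : measurable_fun setT (@tsum R m).
Proof. by apply: measurable_sum => i; exact: measurable_tnth. Qed.

Lemma tsum_pos_gt0 (x : m.-tuple R) : 0 < tsum_pos x.
Proof. by rewrite /tsum_pos; case: ifPn. Qed.

Lemma measurable_tsum_pos : measurable_fun setT (@tsum_pos R m).
Proof.
apply: measurable_fun_ifT => //; last exact: measurable_tsum.
by apply: measurable_fun_ltr => //; exact: measurable_tsum.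
Qed.

End tsum.

Lemma tsum_pos_ae (R : realType) (k m : nat) (theta : R)
    d (T : measurableType d) (P : probability T R) (X : 'I_m -> {RV P >-> R}) :
  (2 <= k)%N -> (1 <= m)%N -> iid_gamma P k theta X ->
  {ae distribution P (sample X), forall x, tsum_pos x = tsum x}.
Proof.
move=> k2 m1 [_ lawX].
pose N : set (m.-tuple R) :=
  \big[setU/set0]_(i < m) [set x | tnth x i <= 0].
have N0 : (distribution P (sample X)).-negligible N.
  apply: (big_ind (fun A => (distribution P (sample X)).-negligible A)).
  - exact: negligible_set0.
  - by move=> A B; exact: negligibleU.
  move=> i _; exists [set x | tnth x i <= 0]; split => //.
    rewrite -[X in measurable X]setTI.
    rewrite (_ : [set x | tnth x i <= 0] = (fun x => tnth x i) @^-1` `]-oo, 0]).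
      exact: measurable_tnth.
    by apply/seteqP; split => x; rewrite /= in_itv.
  have := lawX i `]-oo, 0]%classic; rewrite gamma_law_le0// => <-//.
  congr (P _); apply/seteqP; split => w; rewrite /= in_itv/= tnth_mktuple//.
apply: negligibleS N0 => x /= /eqP; apply: contraPP; rewrite /N -bigcup_seq => H.
suff S0 : 0 < tsum x by rewrite /tsum_pos S0 eqxx.
have x0 i : 0 < tnth x i.
  rewrite ltNge; apply/negP => xi; apply: H; exists i => //=.
  by rewrite mem_index_enum.
rewrite /tsum (bigD1 (Ordinal m1))//= ltr_pwDl// sumr_ge0// => i _.
exact: ltW.
Qed.

(** * Optimality of [xi_hat] *)

(* When k * m = 2 both mean square errors are +oo, and so is the quotient on
   the last line, since 0^-1 = +oo in \bar R. *)
Theorem corollary2p8 (R : realType) (k m : nat) (hk : (2 <= k)%N) (hm : (1 <= m)%N)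
  (d : R -> measure_display)
  (Omega : forall theta : R, measurableType (d theta))
  (P : forall theta : R, probability (Omega theta) R)
  (X : forall theta : R, 'I_m -> {RV (P theta) >-> R})
  (hX : forall theta : R, 0 < theta -> iid_gamma (P theta) k theta (X theta))
  (xi : {mfun m.-tuple R >-> R})
  (hunbiased : forall theta : R, 0 < theta ->
     ('E_(P theta)[fun w => xi (sample (X theta) w)] = theta%:E)%E) :
  forall theta : R, 0 < theta ->
    (mean_square_error (P theta) (X theta) (@xi_hat R k m) theta <=
       mean_square_error (P theta) (X theta) xi theta)%E /\
    mean_square_error (P theta) (X theta) (@xi_hat R k m) theta =
      ((theta ^+ 2)%:E / ((k * m)%:R - 2)%:E)%E.
Proof.
move=> theta theta0.
have [p km] : exists p, (k * m)%N = p.+2.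
  have : (2 <= k * m)%N by rewrite (leq_trans hk)// leq_pmulr.
  by case: (k * m)%N => [|[|p]]//; exists p.
pose nu (t : R) : probability (m.-tuple R) R := distribution (P t) (sample (X t)).
pose T := @tsum_pos R m.
have mT : measurable_fun setT T by exact: measurable_tsum_pos.
have T0 x : 0 < T x by exact: tsum_pos_gt0.
have aeT (t : R) : 0 < t -> {ae nu t, forall x, T x = tsum x}.
  by move=> t0; apply: tsum_pos_ae hk hm (hX t t0).
have rate (t u : R) (f : m.-tuple R -> \bar R) : 0 < t -> 0 <= u ->
    measurable_fun setT f -> (forall x, (0 <= f x)%E) ->
    (\int[nu t]_x ((expR (- u * T x))%:E * f x) =
     ((t / (t + u)) ^+ p.+2)%:E * \int[nu (t + u)%R]_x f x)%E.
  move=> t0 u0 mf f0; have tu0 : 0 < t + u by rewrite ltr_wpDr.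
  rewrite -km -(change_of_rate t0 u0 (hX t t0) (hX _ tu0) mf f0).
  have mexp S : measurable_fun setT S ->
      measurable_fun setT (fun x => (expR (- u * S x))%:E * f x)%E.
    move=> mS; apply: emeasurable_funM => //; apply/measurable_EFinP.
    by apply: measurableT_comp => //; exact: measurable_funM.
  apply: ae_eq_integral => //; [exact: mexp|apply: mexp; exact: measurable_tsum|].
  by apply: filterS (aeT t t0) => x Tx _; rewrite Tx.
have unb (t : R) : 0 < t -> (\int[nu t]_x (xi x)%:E = t%:E)%E.
  move=> t0; rewrite -(hunbiased t t0) unlock integralE [RHS]integralE.
  have mxi : measurable_fun setT (EFin \o xi) by exact/measurable_EFinP.
  congr (_ - _)%E.
    rewrite ge0_integral_distribution//; last exact: measurable_funepos.
    by apply: eq_integral => w _; rewrite /= !funeposE.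
  rewrite ge0_integral_distribution//; last exact: measurable_funeneg.
  by apply: eq_integral => w _; rewrite /= !funenegE.
have mse (f : m.-tuple R -> R) : measurable_fun setT f ->
    mean_square_error (P theta) (X theta) f theta =
    (\int[nu theta]_x ((f x - theta) ^+ 2)%:E)%E.
  move=> mf; rewrite /mean_square_error unlock /nu ge0_integral_distribution//.
    by apply/measurable_EFinP; apply: measurable_funX; exact: measurable_funB.
  by move=> x; rewrite lee_fin sqr_ge0.
have mhat : measurable_fun setT (@xi_hat R k m).
  by apply: measurable_funM => //; apply: measurable_fun_inv; exact: measurable_tsum.
have hatE : (\int[nu theta]_x ((xi_hat k x - theta) ^+ 2)%:E =
    \int[nu theta]_x ((p.+1%:R / T x - theta) ^+ 2)%:E)%E.
  have msq (f : m.-tuple R -> R) : measurable_fun setT f ->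
      measurable_fun setT (fun x => ((f x - theta) ^+ 2)%:E).
    move=> mf; apply/measurable_EFinP; apply: measurable_funX.
    exact: measurable_funB.
  apply: ae_eq_integral => //; first exact: msq.
    by apply: msq; apply: measurable_funM => //; exact: measurable_fun_inv.
  apply: filterS (aeT theta theta0) => x Tx _.
  have -> : p.+1%:R = (k * m)%:R - 1 :> R by rewrite km -[in RHS]natr1 addrK.
  by rewrite Tx.
rewrite !mse// hatE.
have [le eq] := mse_scaled_inverse mT T0 rate theta0 (measurable_funP xi) unb.
split; first exact: le.
by rewrite eq km -(addn2 p) natrD addrK.
Qed.
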